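(* Let $H$ be a separable infinite-dimensional complex Hilbert space, $J$ a conjugation in $H$, and $\mathcal F=\{f_k\}_{k=0}^\infty$ an orthonormal basis in $H$ corresponding to $J$. Let $H_{J;0}=\{x\in H:\ [x,x]_J=0\}$ and $H_R=\{x\in H:\ (x,f_k)\in\mathbb{R}\ \text{for all } k\in\mathbb{Z}_+\}$, and for $k,l\in\mathbb{Z}_+$ let $f_{k,l}^{\pm}=\frac{1}{\sqrt2}(f_k\pm if_l)$. Then: 1. The set $H_{J;0}$ is closed. 2. If $x\in H_{J;0}$, then $Jx\in H_{J;0}$ and $\alpha x\in H_{J;0}$ for all $\alpha\in\mathbb{C}$. 3. If $x,y\in H_{J;0}$ and $[x,y]_J=0$, then $\alpha x+\beta y\in H_{J;0}$ for all $\alpha,\beta\in\mathbb{C}$. 4. $H_{J;0}=\{x\in H:\ x=x_R+ix_I,\ x_R,x_I\in H_R,\ \|x_R\|=\|x_I\|,\ (x_R,x_I)=0\}$. 5. The set $H_{J;0}$ has no inner points. 6. $\operatorname{span}H_{J;0}=H$, where $\operatorname{span}$ denotes the closed linear span. 7. The set $\{f_{2k,2k+1}^+,\,f_{2k,2k+1}^-\}_{k\in\mathbb{Z}_+}$ is an orthonormal basis in $H$ whose elements belong to $H_{J;0}$.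
   Context: $\mathbb{Z}_+$ is the set of non-negative integers. A conjugation in $H$ is a map $J:H\to H$ with $J^2=E$ (the identity) and $(Jx,Jy)=\overline{(x,y)}$ for all $x,y\in H$ (hence $J$ is antilinear). An orthonormal basis $\{f_k\}_{k\in\mathbb{Z}_+}$ of $H$ corresponds to $J$ if $Jx=\sum_{k}\overline{x_k}f_k$ for every $x=\sum_kx_kf_k\in H$. The J-form is $[x,y]_J:=(x,Jy)$, where the scalar product is linear in the first argument. *)

(* Defs.v *)
From HB Require Import structures.
From mathcomp Require Import all_boot all_order all_algebra.
From mathcomp Require Import all_classical all_reals all_analysis.
From mathcomp Require Import complex.

Set Implicit Arguments.
Unset Strict Implicit.
Unset Printing Implicit Defensive.

Import Order.TTheory GRing.Theory Num.Theory Num.Def.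
Import numFieldNormedType.Exports.

Local Open Scope classical_set_scope.
Local Open Scope ring_scope.

(* The algebraic (not closed) linear span. *)
Definition lin_span (K : nzRingType) (V : lmodType K) (A : set V) : set V :=
  [set x | exists (n : nat) (a : 'I_n -> K) (v : 'I_n -> V),
     (forall i, A (v i)) /\ x = \sum_(i < n) a i *: v i].

Definition closed_span (K : numFieldType) (V : normedModType K) (A : set V) :
    set V :=
  closure (lin_span A).

Definition infinite_dimensional (K : nzRingType) (V : lmodType K) : Prop :=
  forall A : set V, finite_set A -> lin_span A <> setT.

Definition separable (T : topologicalType) : Prop :=
  exists2 D : set T, countable D & dense D.

(* A complex Hilbert space is a complete normed space H over R[i] together
   with a form dot : {dot H for conjC} -- linear in the first argument,
   Hermitian, positive definite -- that induces the norm of H. *)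
Definition norm_from_dot (R : realType) (H : completeNormedModType R[i])
    (dot : {dot H for conjC}) : Prop :=
  forall x : H, `|x| ^+ 2 = dot x x.

Definition orthonormal_family (R : realType) (H : completeNormedModType R[i])
    (dot : {dot H for conjC}) (I : eqType) (f : I -> H) : Prop :=
  forall i j, dot (f i) (f j) = (i == j)%:R.

Definition orthonormal_basis (R : realType) (H : completeNormedModType R[i])
    (dot : {dot H for conjC}) (I : eqType) (f : I -> H) : Prop :=
  orthonormal_family dot f /\ closed_span (range f) = setT.

Definition conjugation (R : realType) (H : completeNormedModType R[i])
    (dot : {dot H for conjC}) (J : H -> H) : Prop :=
  (forall x, J (J x) = x) /\ (forall x y, dot (J x) (J y) = (dot x y)^*).

Definition corresponds_to (R : realType) (H : completeNormedModType R[i])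
    (f : nat -> H) (J : H -> H) : Prop :=
  forall (c : nat -> R[i]) (x : H),
    series (fun k => c k *: f k) @ \oo --> x ->
    series (fun k => (c k)^* *: f k) @ \oo --> J x.

Definition J_form (R : realType) (H : completeNormedModType R[i])
    (dot : {dot H for conjC}) (J : H -> H) (x y : H) : R[i] :=
  dot x (J y).

Definition H_J0 (R : realType) (H : completeNormedModType R[i])
    (dot : {dot H for conjC}) (J : H -> H) : set H :=
  [set x | J_form dot J x x = 0].

Definition H_R (R : realType) (H : completeNormedModType R[i])
    (dot : {dot H for conjC}) (f : nat -> H) : set H :=
  [set x | forall k, dot x (f k) \is Num.real].

Definition f_plus (R : realType) (H : completeNormedModType R[i])
    (f : nat -> H) (k l : nat) : H :=
  (sqrtC 2)^-1 *: (f k + 'i *: f l).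

Definition f_minus (R : realType) (H : completeNormedModType R[i])
    (f : nat -> H) (k l : nat) : H :=
  (sqrtC 2)^-1 *: (f k - 'i *: f l).

(* Indexed by nat * bool, so that orthonormality also says that the listed
   vectors are pairwise distinct. *)
Definition f_pm (R : realType) (H : completeNormedModType R[i])
    (f : nat -> H) (p : nat * bool) : H :=
  if p.2 then f_plus f (2 * p.1)%N (2 * p.1).+1%N
  else f_minus f (2 * p.1)%N (2 * p.1).+1%N.

(* Main.v *)
Require Import Defs.
From HB Require Import structures.
From mathcomp Require Import all_boot all_order all_algebra.
From mathcomp Require Import all_classical all_reals all_analysis.
From mathcomp Require Import complex.
From mathcomp Require Import ring zify.

(** The quadratic form x |-> (x, Jx) measures how far the real and imaginary
parts of x, taken with respect to J, are from being orthogonal of equal length.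
Positivity of the scalar product forces J to be antilinear
([conjugationP]), hence isometric and continuous, and the J-form is bilinear
and symmetric ([dot_conjugationC]); this gives the stability of its null cone
under J, under scalars and under sums of J-orthogonal elements.

The vanishing of (x, y) is equivalent to two equalities of norms,
|x + y| = |x - y| and |x + iy| = |x - iy| ([dot_eq0_norm], which is
polarization). Applied to y = Jx this presents the null cone as an intersection
of two sets on which continuous functions have equal norms, so the cone is
closed ([closed_H_J0]).

Each x is u + iv with u, v fixed by J, and
(x, Jx) = |u|^2 - |v|^2 + 2i (u, v). The first of the two norm equalities for
y = Jx reads |2u| = |2iv|, so that x is in the cone exactly when |u| = |v| and
(u, v) = 0 ([H_J0_rectE]). As J fixes every vector of the corresponding basis,
and as a vector orthogonal to a total family is zero, the fixed points of J are
the vectors with real coordinates ([H_R_fixed]).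

If x is interior to the cone then so are x + tw and x - tw for small t, and the
parallelogram identity gives 2 t^2 (w, Jw) = 0 for every w; a basis vector w,
for which (w, Jw) = 1, contradicts this ([interior_H_J0]).

Finally J exchanges f_{k,l}^+ and f_{k,l}^- , so these lie in the cone precisely
because they are orthogonal to each other. Sum and difference of the two
recover f_k and f_l, hence their closed span, and a fortiori that of the cone,
is everything. *)

Set Implicit Arguments.
Unset Strict Implicit.
Unset Printing Implicit Defensive.

Import Order.TTheory GRing.Theory Num.Theory Num.Def.
Import numFieldNormedType.Exports.

Local Open Scope classical_set_scope.
Local Open Scope ring_scope.

(** * Linear spans *)

Lemma lin_span_incl (K : nzRingType) (V : lmodType K) (A : set V) :
  A `<=` lin_span A.
Proof.
move=> x Ax; exists 1%N, (fun=> 1), (fun=> x); split=> //.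
by rewrite big_ord1 scale1r.
Qed.

Lemma lin_span0 (K : nzRingType) (V : lmodType K) (A : set V) : lin_span A 0.
Proof. by exists 0%N, (fun=> 0), (fun=> 0); split; [case|rewrite big_ord0]. Qed.

Lemma lin_spanD (K : nzRingType) (V : lmodType K) (A : set V) (x y : V) :
  lin_span A x -> lin_span A y -> lin_span A (x + y).
Proof.
move=> [n [a [v [Av ->]]]] [m [b [w [Aw ->]]]].
exists (n + m)%N,
  (fun i => match fintype.split i with inl j => a j | inr j => b j end),
  (fun i => match fintype.split i with inl j => v j | inr j => w j end).
split=> [i|]; first by case: fintype.split.
rewrite big_split_ord/=; congr (_ + _); apply: eq_bigr => i _.
  by rewrite (unsplitK (inl i)).
by rewrite (unsplitK (inr i)).
Qed.

Lemma lin_spanZ (K : nzRingType) (V : lmodType K) (A : set V) (c : K) (x : V) :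
  lin_span A x -> lin_span A (c *: x).
Proof.
move=> [n [a [v [Av ->]]]]; exists n, (fun i => c * a i), v; split=> //.
by rewrite scaler_sumr; apply: eq_bigr => i _; rewrite scalerA.
Qed.

Lemma lin_span_min (K : nzRingType) (V : lmodType K) (A B : set V) :
  A `<=` lin_span B -> lin_span A `<=` lin_span B.
Proof.
move=> AB _ [n [a [v [Av ->]]]].
elim/big_ind : _ => [|x y|i _]; [exact: lin_span0|exact: lin_spanD|].
exact/lin_spanZ/AB.
Qed.

Lemma closed_span_min (K : numFieldType) (V : normedModType K) (A B : set V) :
  A `<=` lin_span B -> closed_span A `<=` closed_span B.
Proof. by move=> AB; apply/closure_subset/lin_span_min. Qed.

(** * Orthogonality and norms *)

Section DotProduct.
Variables (R : realType) (H : completeNormedModType R[i]).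
Variable dot : {dot H for conjC}.

Lemma dotC (x y : H) : dot x y = (dot y x)^*.
Proof. by rewrite hermC /= expr0 mul1r. Qed.

Lemma dotZl (a : R[i]) (x y : H) : dot (a *: x) y = a * dot x y.
Proof. by rewrite linearZl_LR. Qed.

Lemma dotZr (a : R[i]) (x y : H) : dot x (a *: y) = a^* * dot x y.
Proof. by rewrite linearZr_LR. Qed.

Lemma dot_inj (x y : H) : (forall z, dot x z = dot y z) -> x = y.
Proof.
move=> xy; apply/eqP; rewrite -subr_eq0 -(dnorm_eq0 dot) linearBl /=.
by rewrite xy subrr.
Qed.

Lemma eq_norm_dot (x y : H) : norm_from_dot dot ->
  dot x x = dot y y <-> `|x| = `|y|.
Proof.
move=> hdot; rewrite -!hdot; split => [/eqP|->//].
by rewrite eqrXn2// => /eqP.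
Qed.

(** By polarization: the differences of the squares of the two pairs of norms
are 4 Re (x, y) and 4 Im (x, y). Orthogonality is thereby expressed through the
norm alone, which is continuous by the triangle inequality. *)
Lemma dot_eq0_norm (x y : H) : norm_from_dot dot ->
  dot x y = 0 <->
  `|x + y| = `|x - y| /\ `|x + 'i *: y| = `|x - 'i *: y|.
Proof.
move=> hdot.
rewrite -!(eq_norm_dot _ _ hdot) !dnormB !dnormD !dotZl !dotZr conjCi.
set d := dot x y; set a := dot x x + _; set b := dot x x + _.
rewrite rmorphM /= rmorphN /= conjCi opprK; split=> [->|[h1 h2]].
  by rewrite rmorph0 !mulr0 !addr0 !subr0.
have {}h1 : d + d^* = 0.
  move/eqP: h1; rewrite -subr_eq0 opprD opprK addrACA subrr add0r -mulr2n.
  by rewrite mulrn_eq0 => /eqP.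
have {}h2 : - d + d^* = 0.
  move/eqP: h2; rewrite -subr_eq0 opprD opprK addrACA subrr add0r -mulr2n.
  rewrite mulrn_eq0 /= mulNr -mulrN -mulrDr mulf_eq0 (negPf (neq0Ci _)).
  by move/eqP.
have /eqP : (d + d^*) - (- d + d^*) = 0 by rewrite h1 h2 subrr.
by rewrite opprD opprK addrACA subrr addr0 -mulr2n mulrn_eq0 => /eqP.
Qed.

(** If x is orthogonal to the span, Pythagoras gives |x - y| >= |x| for every y
in the span, so a nonzero x is not in its closure. *)
Lemma total_dot_eq0 (I : eqType) (f : I -> H) (x : H) :
    norm_from_dot dot -> closed_span (range f) = setT ->
  (forall k, dot x (f k) = 0) -> x = 0.
Proof.
move=> hdot hf xf; apply: contrapT => /eqP x0.
have : closed_span (range f) x by rewrite hf.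
move=> /(_ (ball x `|x|)) /(_ (nbhsx_ballx _ _ _)).
rewrite normr_gt0 => /(_ x0) [y [[n [a [v [fv yE]]]]]].
rewrite -ball_normE /=; apply/negP.
have xy : dot x y = 0.
  rewrite yE linear_sumr /= big1// => i _; have [k _ <-] := fv i.
  by rewrite dotZr xf mulr0.
suff h : `|x| <= `|x - y| by rewrite le_gtF.
rewrite -(@ler_pXn2r _ 2)// ?nnegrE// !hdot hnormBd//.
by rewrite lerDl dnorm_ge0.
Qed.

End DotProduct.

Lemma closed_eq_norm (K : numFieldType) (T : topologicalType)
    (V : normedModType K) (g h : T -> V) :
  continuous g -> continuous h -> closed [set x | `|g x| = `|h x|].
Proof.
move=> cg ch.
have -> : [set x | `|g x| = `|h x|] =
    (fun x => `|g x| - `|h x| : K^o) @^-1` [set 0].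
  apply/seteqP; split=> x /=; first by move=> ->; rewrite subrr.
  by move/eqP; rewrite subr_eq0 => /eqP.
apply: closed_comp; last first.
  exact/accessible_closed_set1/hausdorff_accessible/norm_hausdorff.
by move=> x _; apply: (@cvgB K K^o); apply: cvg_norm; [exact: cg|exact: ch].
Qed.

(** * Conjugations and the null cone of the J-form *)

Section Conjugation.
Variables (R : realType) (H : completeNormedModType R[i]).
Variables (dot : {dot H for conjC}) (J : H -> H).
Hypothesis hJ : conjugation dot J.

(** Both sides have the same scalar product with every z: as z = J (J z), the
factor J can be moved out of (J _, J (J z)) on either side. *)
Lemma conjugationP (a : R[i]) (x y : H) : J (a *: x + y) = a^* *: J x + J y.
Proof.
case: hJ => JK dotJ; apply: (dot_inj (dot := dot)) => z.
by rewrite -[z]JK linearPl /= !dotJ linearPl /= rmorphD rmorphM.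
Qed.

Lemma conjugationD (x y : H) : J (x + y) = J x + J y.
Proof. by rewrite -[x]scale1r conjugationP rmorph1 !scale1r. Qed.

Lemma conjugation0 : J 0 = 0.
Proof. by apply: (addIr (J 0)); rewrite -conjugationD !add0r. Qed.

Lemma conjugationZ (a : R[i]) (x : H) : J (a *: x) = a^* *: J x.
Proof. by rewrite -[a *: x]addr0 conjugationP conjugation0 addr0. Qed.

Lemma conjugationN (x : H) : J (- x) = - J x.
Proof. by rewrite -scaleN1r conjugationZ rmorphN rmorph1 scaleN1r. Qed.

Lemma conjugationB (x y : H) : J (x - y) = J x - J y.
Proof. by rewrite conjugationD conjugationN. Qed.

Lemma norm_conjugation (x : H) : norm_from_dot dot -> `|J x| = `|x|.
Proof. by move=> hdot; apply/(eq_norm_dot _ _ hdot); rewrite hJ.2 -dotC. Qed.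

Lemma conjugation_continuous : norm_from_dot dot -> continuous J.
Proof.
move=> hdot x; apply/cvgrPdist_lt => e e0.
have : nbhs x (ball x e) by exact: nbhsx_ballx.
rewrite -ball_normE; apply: filterS => y /= xy.
by rewrite -conjugationB norm_conjugation.
Qed.

(** Symmetry of the J-form: J conjugates the scalar product, so applying it to
both arguments exchanges their roles. *)
Lemma dot_conjugationC (x y : H) : dot x (J y) = dot y (J x).
Proof. by rewrite dotC -hJ.2 hJ.1. Qed.

(** The condition (x, Jx) = 0 amounts to two equalities between norms of vectors
depending continuously on x. *)
Lemma closed_H_J0 : norm_from_dot dot -> closed (H_J0 dot J).
Proof.
move=> hdot.
have cN (a : R[i]) : continuous (fun x => x + a *: J x).
  move=> x; apply: cvgD; first exact: cvg_id.
  by apply: cvgZr; exact: conjugation_continuous.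
have -> : H_J0 dot J =
    [set x | `|x + 1 *: J x| = `|x + (-1) *: J x|] `&`
    [set x | `|x + 'i *: J x| = `|x + (- 'i) *: J x|].
  apply/seteqP; split=> x /=;
   by rewrite /H_J0 /J_form /= dot_eq0_norm// scale1r scaleN1r scaleNr.
by apply: closedI; exact: (closed_eq_norm (cN _) (cN _)).
Qed.

Lemma H_J0_conjugation (x : H) : H_J0 dot J x -> H_J0 dot J (J x).
Proof. by rewrite /H_J0 /J_form /= hJ.2 => ->; rewrite conjC0. Qed.

Lemma H_J0_lin (x y : H) :
    H_J0 dot J x -> H_J0 dot J y -> J_form dot J x y = 0 ->
  forall a b : R[i], H_J0 dot J (a *: x + b *: y).
Proof.
rewrite /H_J0 /J_form /= => xx yy xy a b.
rewrite conjugationD !conjugationZ !linearDl !linearDr /= !dotZl !dotZr.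
by rewrite [dot y (J x)]dot_conjugationC xx yy xy !mulr0 !addr0.
Qed.

Lemma H_J0Z (x : H) (a : R[i]) : H_J0 dot J x -> H_J0 dot J (a *: x).
Proof.
by rewrite /H_J0 /J_form /= conjugationZ dotZl dotZr => ->; rewrite !mulr0.
Qed.

(** For small t > 0 the vectors x + tw, x - tw and x would all be in the cone,
and the parallelogram identity for the J-form would put tw, hence w, there
too. *)
Lemma interior_H_J0 (w : H) : J_form dot J w w != 0 -> (H_J0 dot J)° = set0.
Proof.
move=> qw; rewrite -subset0 => x.
have : w != 0 by apply: contraNneq qw => ->; rewrite /J_form linear0l.
rewrite -normr_gt0 => w0.
rewrite /interior -nbhs_ballE => -[e /= e0].
rewrite -ball_normE /= => sub.
(* With this t the vector t *: w has norm e / 2. *)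
pose t : R[i] := e / (2 * `|w|).
have t0 : 0 < t by rewrite divr_gt0// mulr_gt0.
have tw : `|t *: w| < e.
  rewrite normrZ gtr0_norm// /t invfM mulrA mulfVK ?gt_eqF//.
  by rewrite ltr_pdivrMr// ltr_pMr// ltr1n.
have plus : H_J0 dot J (x + t *: w).
  by apply: sub; rewrite /= opprD addrA subrr sub0r normrN.
have minus : H_J0 dot J (x - t *: w).
  by apply: sub; rewrite /= opprB addrCA subrr addr0.
have x0 : H_J0 dot J x.
  by apply: sub; rewrite /= subrr normr0.
have : H_J0 dot J (t *: w).
  move: plus minus x0; rewrite /H_J0 /J_form /= conjugationB conjugationD.
  rewrite !linearDl !linearDr !linearNl !linearNr /=.
  move: (dot _ _) (dot _ _) (dot _ _) (dot _ _) => d c b a h1 h2 h3.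
  have : d *+ 2 = (a + b + (c + d)) + (a - b + (- c - - d)) - a *+ 2 by ring.
  by rewrite h1 h2 h3 mul0rn !addr0 subr0 => /eqP; rewrite mulrn_eq0 => /eqP.
move=> /(H_J0Z t^-1); rewrite scalerA mulVf ?gt_eqF// scale1r.
by move/eqP; rewrite -[_ == 0]/(J_form dot J w w == 0) (negPf qw).
Qed.

(** The cross terms add up because (v, u) = (u, v): both vectors being fixed by
J, their scalar product is its own conjugate. *)
Lemma J_form_rect (u v : H) : J u = u -> J v = v ->
  J_form dot J (u + 'i *: v) (u + 'i *: v) =
  dot u u - dot v v + 'i * dot u v *+ 2.
Proof.
move=> Ju Jv; rewrite /J_form conjugationD conjugationZ Ju Jv.
have vu : dot v u = dot u v by rewrite dotC -hJ.2 Ju Jv.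
rewrite !linearDl !linearDr /= !dotZl !dotZr.
by rewrite conjCK vu mulrA -expr2 sqrCi mulN1r mulr2n !addrA addrAC; ring.
Qed.

Definition real_part (x : H) : H := 2^-1 *: (x + J x).

Lemma conjugation_real_part (x : H) : J (real_part x) = real_part x.
Proof.
by rewrite /real_part conjugationZ conjugationD hJ.1 fmorphV /= conjC_nat addrC.
Qed.

(** The imaginary part of x is obtained as the real part of - i x. *)
Lemma real_partK (x : H) : x = real_part x + 'i *: real_part (- 'i *: x).
Proof.
rewrite /real_part conjugationZ rmorphN /= conjCi opprK.
rewrite scalerA [_ * 2^-1]mulrC -scalerA -scalerDr.
rewrite (scalerDr 'i) !scalerA mulrN -expr2 sqrCi opprK scale1r scaleN1r.
by rewrite addrACA subrr addr0 -mulr2n -(scaler_nat 2 x) scalerA mulVf ?scale1r.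
Qed.

(** With x = u + iv the vectors x + Jx and x - Jx are 2u and 2iv, so that
equality of their norms is |u| = |v|; the value of the J-form then leaves
(u, v) = 0. *)
Lemma H_J0_rectE : norm_from_dot dot ->
  H_J0 dot J = [set x | exists u v : H,
    [/\ x = u + 'i *: v, J u = u, J v = v, `|u| = `|v| & dot u v = 0]].
Proof.
move=> hdot; apply/seteqP; split=> [x x0|_ [u] [v] [-> Ju Jv uv duv]] /=;
    last first.
  move/(eq_norm_dot _ _ hdot): uv => uv.
  by rewrite /H_J0 /= J_form_rect// uv duv mulr0 mul0rn subrr addr0.
have [u [v [xE Ju Jv]]] : exists u v, [/\ x = u + 'i *: v, J u = u & J v = v].
  exists (real_part x), (real_part (- 'i *: x)).
  by split; [exact: real_partK|exact: conjugation_real_part..].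
have [+ _] := (dot_eq0_norm _ _ hdot).1 x0.
rewrite xE conjugationD conjugationZ Ju Jv conjCi scaleNr.
rewrite addrACA subrr addr0 opprD opprK addrACA subrr add0r -!mulr2n.
rewrite !normrMn normrZ normCi mul1r => /eqP; rewrite eqrMn2r => /eqP uv.
exists u, v; split=> //.
have /(eq_norm_dot _ _ hdot) duv := uv.
move: x0; rewrite /H_J0 /= xE J_form_rect// duv subrr add0r.
by move/eqP; rewrite mulrn_eq0 /= mulf_eq0 (negPf (neq0Ci _)) => /eqP.
Qed.

End Conjugation.

(** * The basis corresponding to J *)

Section CorrespondingBasis.
Variables (R : realType) (H : completeNormedModType R[i]).
Variables (dot : {dot H for conjC}) (f : nat -> H).

(** The two families in a single formula: the sign of the second summand is +
for [b = true]. *)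
Lemma f_pmE (k : nat) (b : bool) :
  f_pm f (k, b) =
  (sqrtC 2)^-1 *: (f (2 * k)%N + ((-1) ^+ (~~ b) * 'i) *: f (2 * k).+1).
Proof.
by rewrite /f_pm /=; case: b; rewrite /= ?expr0 ?mul1r ?expr1 ?mulN1r ?scaleNr.
Qed.

(** Different pairs involve disjoint sets of basis vectors; within one pair the
scalar product is (1 + 1) / 2 or (1 - 1) / 2 according to whether the two signs
agree. *)
Lemma f_pm_orthonormal : orthonormal_family dot f ->
  orthonormal_family dot (f_pm f).
Proof.
move=> hf [k b] [l c].
rewrite !f_pmE.
rewrite dotZl dotZr mulrA !linearDl !linearDr /= !dotZl !dotZr !hf.
have r2 : (sqrtC 2)^-1 * ((sqrtC 2)^-1)^* = 2^-1 :> R[i].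
  by rewrite -normCK normfV ger0_norm ?sqrtC_ge0// exprVn sqrtCK.
have odd_even m n : ((2 * m).+1 == (2 * n)%N) = false by lia.
have even_odd m n : ((2 * m)%N == (2 * n).+1) = false by lia.
rewrite odd_even even_odd eqSS eqn_pmul2l// r2 xpair_eqE !mulr0 addr0 add0r.
case: (k == l) => /=; last by rewrite !mulr0 addr0.
have cross :
    ((-1) ^+ (~~ b) * 'i) * ((-1) ^+ (~~ c) * 'i)^* =
    (-1) ^+ (b != c) :> R[i].
  rewrite rmorphM rmorph_sign /= conjCi mulrACA mulrN -expr2 sqrCi opprK mulr1.
  by rewrite -signr_addb; case: b c => -[].
rewrite !mulr1 cross; case: eqP => _ /=; rewrite ?expr0 ?expr1.
  by rewrite mulr1 -mulr2n -(mulr_natr 2^-1 2) mulVf ?pnatr_eq0.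
by rewrite mulrN1 subrr.
Qed.

(** Half the sum of f^+ and f^-, and their difference divided by 2i, are the two
basis vectors up to the normalizing factor. *)
Lemma range_f_pm : range f `<=` lin_span (range (f_pm f)).
Proof.
have r0 : sqrtC 2 != 0 :> R[i] by rewrite sqrtC_eq0 pnatr_eq0.
have two0 : 2 != 0 :> R[i] by rewrite pnatr_eq0.
have pmE k b : lin_span (range (f_pm f))
    (f (2 * k)%N + ((-1) ^+ (~~ b) * 'i) *: f (2 * k).+1).
  have := lin_spanZ (sqrtC 2) (lin_span_incl (imageT (f_pm f) (k, b))).
  by rewrite f_pmE scalerA mulfV// scale1r.
move=> _ [n _ <-].
have [k [->|->]] : exists k, n = (2 * k)%N \/ n = (2 * k).+1.
  exists n./2; rewrite -{1 3}(odd_double_half n) -mul2n.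
  by case: odd; [right|left].
- have := lin_spanZ 2^-1 (lin_spanD (pmE k true) (pmE k false)).
  rewrite /= expr0 expr1 mul1r mulN1r scaleNr addrACA subrr addr0.
  by rewrite -mulr2n -(scaler_nat 2 (f _)) scalerA mulVf// scale1r.
- have := lin_spanZ (2 * 'i)^-1
    (lin_spanD (pmE k true) (lin_spanZ (-1) (pmE k false))).
  rewrite /= expr0 expr1 mul1r mulN1r scaleN1r scaleNr opprD opprK addrACA subrr.
  rewrite add0r -mulr2n -(scaler_nat 2 ('i *: f _)) !scalerA mulVf ?scale1r//.
  by rewrite mulf_neq0// neq0Ci.
Qed.

Variable J : H -> H.

(** The series with the single coefficient 1 at k is its own conjugate. *)
Lemma corresponds_to_fix (k : nat) : corresponds_to f J -> J (f k) = f k.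
Proof.
move=> hfJ.
pose c (j : nat) : R[i] := (j == k)%:R.
have cE : (fun j => (c j)^* *: f j) = (fun j => c j *: f j).
  by apply/funext => j; rewrite conjC_nat.
have fk : series (fun j => c j *: f j) @ \oo --> f k.
  apply: cvg_near_cst; exists k.+1 => // n /= kn.
  rewrite /series /= (bigD1_seq k) ?iota_uniq ?mem_index_iota//= /c eqxx scale1r.
  by rewrite big1 ?addr0// => j /negPf ->; rewrite scale0r.
have := hfJ c (f k) fk; rewrite cE => Jfk.
by apply: cvg_unique Jfk fk; exact: norm_hausdorff.
Qed.

Hypothesis hJ : conjugation dot J.

(** The coordinates of J x are the conjugates of those of x, and coordinates
determine a vector. *)
Lemma H_R_fixed : norm_from_dot dot -> closed_span (range f) = setT ->
  (forall k, J (f k) = f k) ->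
  H_R dot f = [set x | J x = x].
Proof.
move=> hdot hf Jf; apply/seteqP; split=> x /= hx; last first.
  by move=> k; apply/CrealP; rewrite -hJ.2 hx Jf.
apply/eqP; rewrite -subr_eq0; apply/eqP; apply: (total_dot_eq0 hdot hf) => k.
by rewrite linearBl /= -{1}[f k]Jf hJ.2 (CrealP (hx k)) subrr.
Qed.

(** J fixes the basis vectors and conjugates the coefficient i. *)
Lemma conjugation_f_pm (k : nat) (b : bool) :
  (forall k, J (f k) = f k) -> J (f_pm f (k, b)) = f_pm f (k, ~~ b).
Proof.
move=> Jf; rewrite !f_pmE !(conjugationZ hJ, conjugationD hJ) !Jf.
rewrite conj_Creal ?realV ?ger0_real ?sqrtC_ge0//.
rewrite rmorphM rmorph_sign /= conjCi mulrN -mulNr.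
by case: b; rewrite /= ?expr0 ?expr1 ?opprK.
Qed.

(** The value of the J-form at one vector of the family is its scalar product
with its partner in the pair, which is a different member of an orthonormal
family. *)
Lemma H_J0_f_pm : orthonormal_family dot f ->
  (forall k, J (f k) = f k) -> forall p, H_J0 dot J (f_pm f p).
Proof.
move=> hf Jf [k b]; rewrite /H_J0 /J_form /= conjugation_f_pm//.
by rewrite (f_pm_orthonormal hf) xpair_eqE eqxx; case: b.
Qed.

End CorrespondingBasis.

(** * The theorem *)

Theorem theorem4p1 (R : realType) (H : completeNormedModType R[i])
    (dot : {dot H for conjC}) (hdot : norm_from_dot dot)
    (hsep : separable H) (hdim : infinite_dimensional H)
    (J : H -> H) (hJ : conjugation dot J)
    (f : nat -> H) (hf : orthonormal_basis dot f) (hfJ : corresponds_to f J) :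
  closed (H_J0 dot J)
  /\ (forall x, H_J0 dot J x ->
        H_J0 dot J (J x) /\ forall a : R[i], H_J0 dot J (a *: x))
  /\ (forall x y, H_J0 dot J x -> H_J0 dot J y -> J_form dot J x y = 0 ->
        forall a b : R[i], H_J0 dot J (a *: x + b *: y))
  /\ H_J0 dot J =
       [set x | exists xR xI : H,
          [/\ x = xR + 'i *: xI, H_R dot f xR, H_R dot f xI,
              `|xR| = `|xI| & dot xR xI = 0]]
  /\ (H_J0 dot J)° = set0
  /\ closed_span (H_J0 dot J) = setT
  /\ orthonormal_basis dot (f_pm f)
     /\ (forall p, H_J0 dot J (f_pm f p)).
Proof.
have [fO fT] := hf.
have Jf k : J (f k) = f k by exact: corresponds_to_fix.
have coneP : forall p, H_J0 dot J (f_pm f p) by exact: H_J0_f_pm.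
have pmT : closed_span (range (f_pm f)) = setT.
  apply/seteqP; split=> // x _; apply: closed_span_min (@range_f_pm _ _ f) _ _.
  by rewrite fT.
split; first exact: closed_H_J0.
split.
  move=> x x0; split; first exact: H_J0_conjugation.
  by move=> a; exact: H_J0Z.
split; first exact: H_J0_lin.
split; first by rewrite (H_J0_rectE hJ hdot) (H_R_fixed hJ hdot fT Jf).
split.
  apply: (interior_H_J0 hJ (w := f 0%N)).
  by rewrite /J_form Jf fO eqxx oner_eq0.
split.
  apply/seteqP; split=> // x _.
  have : closed_span (range (f_pm f)) x by rewrite pmT.
  apply: closed_span_min => _ [p _ <-]; exact/lin_span_incl/coneP.
by do !split => //; exact: f_pm_orthonormal.
Qed.
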